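(* Let $\mathcal{O}$ be a nonempty set of quantum channels on $n$ qubits closed under composition, $\Psi$ a channel on $n$ qubits with $\gamma(\Psi)<\infty$, and $k\ge0$ an integer. Then for every sample $S=(z_1,\ldots,z_m)$, \[ \hat{G}_S(\mathcal{F}(\mathcal{O}^{(k)}_\Psi))\le\gamma^*\,\hat{G}_S(\mathcal{F}(\mathcal{O})),\qquad\gamma^*=\min\{1+2\gamma_{\max,n},(1+2\gamma(\Psi))^k\}, \] and for every distribution $D$, $G_D(\mathcal{F}(\mathcal{O}^{(k)}_\Psi))\le\gamma^*G_D(\mathcal{F}(\mathcal{O}))$.
   Context: A quantum channel on $n$ qubits is a completely positive trace-preserving linear map on $2^n\times2^n$ complex matrices. For a channel $\Phi$, $f_\Phi(x,y)=\mathrm{Tr}[\Phi(|x\rangle\langle x|)\,|y\rangle\langle y|]$; $\mathcal{F}(\Omega)=\{f_\Phi:\Phi\in\Omega\}$. Empirical Gaussian complexity: $\hat{G}_S(\mathcal{G})=\mathbb{E}_{g}[\sup_{h\in\mathcal{G}}\frac1m\sum_i g_i h(z_i)]$ with $g_i$ i.i.d. $\mathcal{N}(0,1)$; $G_D(\mathcal{G})=\mathbb{E}_{S\sim D^m}\hat{G}_S(\mathcal{G})$. Free robustness w.r.t. $\mathcal{O}$: $\gamma(\Phi)=\inf\{\lambda\ge0:\exists\,\Phi'\in\mathrm{Conv}(\mathcal{O}),\ (\Phi+\lambda\Phi')/(1+\lambda)\in\mathrm{Conv}(\mathcal{O})\}$; $\gamma_{\max,n}=\sup$ of $\gamma(\Phi)$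 over all channels on $n$ qubits (if infinite, $\gamma^*=(1+2\gamma(\Psi))^k$). $\mathcal{O}^{(k)}_\Psi$ is the set of all finite compositions of elements of $\mathcal{O}\cup\{\Psi\}$ in which $\Psi$ appears at most $k$ times. *)

(* Defs.v *)
From HB Require Import structures.
From mathcomp Require Import all_boot all_order all_algebra.
From mathcomp Require Import all_classical all_reals all_analysis.
From mathcomp Require Import complex mxtens.
Set Implicit Arguments.
Unset Strict Implicit.
Unset Printing Implicit Defensive.
Import Order.TTheory GRing.Theory Num.Theory.
Local Open Scope classical_set_scope.
Local Open Scope ring_scope.

Definition qdim (n : nat) : nat := (2 ^ n)%N.

Notation qmat R n := 'M[(complex R)]_(qdim n).

(* Linear maps on 2^n x 2^n complex matrices (linearity is part of is_channel). *)
Notation qmap R n := (qmat R n -> qmat R n).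

Definition psd (C : numClosedFieldType) (d : nat) (A : 'M[C]_d) : Prop :=
  map_mx Num.conj A^T = A /\
  forall v : 'cV[C]_d, 0 <= ((map_mx Num.conj v)^T *m A *m v) ord0 ord0.

(* id_k (x) Phi acting on a (k*d) x (k*d) matrix viewed as a k x k array of
   d x d blocks (index p of 'I_(k*d) <-> pair (a, i) with a : 'I_k, i : 'I_d). *)
Definition ampl (R : realType) (n k : nat) (Phi : qmap R n)
    (X : 'M[complex R]_(k * qdim n)) : 'M[complex R]_(k * qdim n) :=
  \matrix_(p, q)
    Phi (\matrix_(i, j) X (mxtens_index ((mxtens_unindex p).1, i))
                          (mxtens_index ((mxtens_unindex q).1, j)))
        (mxtens_unindex p).2 (mxtens_unindex q).2.

Definition is_channel (R : realType) (n : nat) (Phi : qmap R n) : Prop :=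
  (forall (a : complex R) (X Y : qmat R n), Phi (a *: X + Y) = a *: Phi X + Phi Y) /\
  (forall (k : nat) (X : 'M[complex R]_(k * qdim n)), psd X -> psd (ampl Phi X)) /\
  (forall X : qmat R n, \tr (Phi X) = \tr X).

Definition conv_hull (R : realType) (n : nat) (O : set (qmap R n)) : set (qmap R n) :=
  [set Phi | exists (l : nat) (w : 'I_l -> R) (P : 'I_l -> qmap R n),
     (forall j, 0 <= w j) /\ \sum_(j < l) w j = 1 /\ (forall j, O (P j)) /\
     Phi = (fun X => \sum_(j < l) real_complex R (w j) *: P j X)].

(* Free robustness of Phi w.r.t. O (inf of the empty set is +oo). *)
Definition robustness (R : realType) (n : nat) (O : set (qmap R n)) (Phi : qmap R n)
  : \bar R :=
  ereal_inf [set lam%:E | lam in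
    [set lam : R | 0 <= lam /\ exists Phi' : qmap R n, conv_hull O Phi' /\
       conv_hull O (fun X => (real_complex R (1 + lam))^-1 *:
                             (Phi X + real_complex R lam *: Phi' X))]].

Definition gamma_max (R : realType) (n : nat) (O : set (qmap R n)) : \bar R :=
  ereal_sup [set robustness O Phi | Phi in [set Phi | is_channel Phi]].

(* gamma^* = min {1 + 2 gamma_max, (1 + 2 gamma(Psi))^k} (in \bar R);
   used only under the hypothesis gamma(Psi) < +oo, so fine is exact. *)
Definition gamma_star (R : realType) (n : nat) (O : set (qmap R n)) (Psi : qmap R n)
    (k : nat) : \bar R :=
  Order.min (1 + 2%:E * gamma_max O)%E
            (((1 + 2 * fine (robustness O Psi)) ^+ k)%:E).

(* O^{(k)}_Psi: nonempty finite compositions of elements of O u {Psi} with Psi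
   (encoded as None) occurring at most k times. *)
Definition comp_k (R : realType) (n : nat) (O : set (qmap R n)) (Psi : qmap R n)
    (k : nat) : set (qmap R n) :=
  [set Phi | exists s : seq (option (qmap R n)),
     (0 < size s)%N /\
     (forall j, (j < size s)%N ->
        match nth None s j with Some f => O f | None => True end) /\
     (count (fun o => if o is None then true else false) s <= k)%N /\
     Phi = foldr (fun o acc => odflt Psi o \o acc) idfun s].

(* Input domain: pairs (x, y) of computational-basis labels. *)
Notation Zdom n := ('I_(qdim n) * 'I_(qdim n))%type.

(* f_Phi(x,y) = Tr[Phi(|x><x|) |y><y|] (real part; the value is real). *)
Definition fPhi (R : realType) (n : nat) (Phi : qmap R n) (z : Zdom n) : R :=
  complex.Re (\tr (Phi (delta_mx z.1 z.1) *m delta_mx z.2 z.2)).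

Definition Fcls (R : realType) (n : nat) (W : set (qmap R n)) : set (Zdom n -> R) :=
  [set fPhi Phi | Phi in W].

(* Expectation of F(g) for g = (g_0,...,g_{m-1}) i.i.d. N(0,1), as the iterated
   integral against the standard normal law (coordinates beyond m set to 0). *)
Fixpoint gauss_exp (R : realType) (m : nat) (F : (nat -> R) -> \bar R) : \bar R :=
  match m with
  | 0 => F (fun _ => 0)
  | m'.+1 => (\int[normal_prob (0:R) 1]_x
                 gauss_exp m' (fun g => F (fun i => if i is j.+1 then g j else x)))%E
  end.

Definition emp_gc (R : realType) (T : Type) (m : nat) (S : m.-tuple T)
    (G : set (T -> R)) : \bar R :=
  gauss_exp m (fun g => ereal_sup
    [set ((m%:R)^-1 * \sum_(i < m) g i * h (tnth S i))%:E | h in G]).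

Definition is_distr (R : realType) (T : finType) (D : T -> R) : Prop :=
  (forall t, 0 <= D t) /\ \sum_t D t = 1.

Definition exp_gc (R : realType) (T : finType) (m : nat) (D : T -> R)
    (G : set (T -> R)) : \bar R :=
  (\sum_(S : m.-tuple T) (\prod_(i < m) D (tnth S i))%:E * emp_gc S G)%E.

(* Main.v *)
Require Import Defs.
From HB Require Import structures.
From mathcomp Require Import all_boot all_order all_algebra.
From mathcomp Require Import all_classical all_reals all_analysis.
From mathcomp Require Import complex mxtens.
From mathcomp Require Import measurable_realfun ring lra.
Import Order.TTheory GRing.Theory Num.Theory.
Import numFieldNormedType.Exports.
Local Open Scope classical_set_scope.
Local Open Scope ring_scope.

(* If Psi has finite robustness then Psi = (1 + b) A - b B with A, B in Conv(O), for b
   arbitrarily close to gamma(Psi).  Such signed decompositions compose, and the total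
   weight 1 + 2b is multiplicative, so a composition with at most k factors Psi is a signed
   combination of total weight at most (1 + 2 gamma(Psi))^k; being a channel, it also has a
   decomposition with b close to gamma_max.  For each Gaussian vector g this gives
     sup_{W} <g, f> <= (1 + b) sup_{O} <g, f> + b sup_{O} <- g, f>,
   and the symmetry of the law of g turns the expectation of the right-hand side into
   1 + 2b times the complexity of O.  Since the functions f_Phi take values in [0, 1], all
   suprema are Lipschitz in g, hence measurable and integrable. *)

Set Implicit Arguments.
Unset Strict Implicit.

(** * The standard normal distribution *)

(** Lebesgue measure is determined by its values on half-open intervals, and reflection sends []a,
    b]] to [[-b, -a[], which has the same length. *)
Lemma lebesgue_measureN (R : realType) (A : set (measurableTypeR R)) : measurable A ->
  pushforward (@lebesgue_measure R) (-%R : R -> R) A = lebesgue_measure A.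
Proof.
move=> mA.
have mN : measurable_fun [set: measurableTypeR R] (-%R : _ -> measurableTypeR R).
  exact: oppr_measurable.
pose N : {mfun measurableTypeR R >-> measurableTypeR R} :=
  HB.pack (-%R : _ -> measurableTypeR R) (isMeasurableFun.Build _ _ _ _ _ mN).
symmetry; have := @lebesgue_measure_unique R (pushforward lebesgue_measure N).
apply => //.
move=> X /ocitvP[->|[[a b] /= ab ->]]; first by rewrite !measure0.
rewrite /pushforward (_ : _ @^-1` _ = `[- b, - a[%classic).
  rewrite !lebesgue_measure_itv/= !lte_fin ltrN2 opprK.
  by case: ifP => // _; rewrite -!EFinD addrC.
apply/seteqP; split => x /=; rewrite !in_itv/= => /andP[u v]; apply/andP; split; lra.
Qed.

Lemma normal_pdfN (R : realType) (s x : R) : s != 0 ->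
  normal_pdf 0 s (- x) = normal_pdf 0 s x.
Proof. by move=> s0; rewrite !normal_pdfE// /normal_fun !subr0 sqrrN. Qed.

(** The density is even and Lebesgue measure is reflection-invariant, so the change of variables
    [x -> - x] fixes the integral of the density. *)
Lemma normal_probN (R : realType) (s : R) (A : set (measurableTypeR R)) : s != 0 ->
  measurable A ->
  pushforward (normal_prob 0 s) (-%R : R -> R) A = normal_prob 0 s A.
Proof.
move=> s0 mA; rewrite /pushforward /normal_prob.
under eq_integral do rewrite -normal_pdfN//.
rewrite -[LHS](@ge0_integral_pushforward _ _ (measurableTypeR R) (measurableTypeR R) R
  (-%R : _ -> _) (@oppr_measurable _ _) lebesgue_measure A (fun y => (normal_pdf 0 s y)%:E)) //.
- by apply: eq_measure_integral => B mB _; exact: lebesgue_measureN.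
- apply/measurable_funTS/measurable_EFinP; exact: measurable_normal_pdf.
- by move=> y _; rewrite lee_fin normal_pdf_ge0.
Qed.

Lemma integral_normal_probN (R : realType) (s : R) (phi : R -> \bar R) : s != 0 ->
  (normal_prob 0 s).-integrable setT phi ->
  (normal_prob 0 s).-integrable setT (phi \o -%R) ->
  (\int[normal_prob 0 s]_x phi (- x)%R = \int[normal_prob 0 s]_x phi x)%E.
Proof.
move=> s0 int intN.
have mN : measurable_fun [set: measurableTypeR R] (-%R : _ -> measurableTypeR R).
  exact: oppr_measurable.
rewrite -[LHS](@integral_pushforward _ _ (measurableTypeR R) (measurableTypeR R) R
  -%R mN (normal_prob 0 s) setT phi) //; last exact: measurable_int int.
pose N : {mfun measurableTypeR R >-> measurableTypeR R} :=
  HB.pack (-%R : _ -> measurableTypeR R) (isMeasurableFun.Build _ _ _ _ _ mN).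
have := @eq_measure_integral _ (measurableTypeR R) R setT (pushforward (normal_prob 0 s) N)
  (normal_prob 0 s) phi.
move=> <- // A mA _; exact/esym/normal_probN.
Qed.

Module RN := Radon_Nikodym_SigmaFinite.

(* The integral of |x| is finite because |x| exp (- x^2 / 2) <= exp (- x^2 / 4),
   the right-hand side being proportional to the density of N(0, 2). *)
Lemma integrable_normal_prob_id (R : realType) :
  (normal_prob (0 : R) 1).-integrable setT (fun x : R => x%:E).
Proof.
apply/integrableP; split; first exact/measurable_EFinP.
pose mu := (@lebesgue_measure R).
pose P := normal_prob (0 : R) 1.
have dom : P `<< mu by exact: normal_prob_dominates.
have mabs : measurable_fun [set: R] (fun x : R => `|x%:E|%E).
  by apply: measurableT_comp => //; exact/measurable_EFinP.
(* The integral against the law becomes a Lebesgue integral against its Radon-Nikodym derivative,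
   which agrees almost everywhere with the explicit density. *)
rewrite -(RN.change_of_variables dom _ measurableT mabs); last by move=> x; exact: abse_ge0.
have mpdf s : measurable_fun [set: R] (fun x : R => (normal_pdf 0 s x)%:E).
  by apply/measurable_EFinP; exact: measurable_normal_pdf.
have fE : ae_eq mu setT (RN.f P mu) (fun x : R => (normal_pdf 0 1 x)%:E).
  apply: integral_ae_eq => //; first exact: RN.f_integrable.
    exact: mpdf.
  by move=> B _ mB; rewrite -RN.f_integral.
rewrite [ltLHS](_ : _ = (\int[mu]_x (`|x%:E| * (normal_pdf 0 1 x)%:E))%E); last first.
  apply: ae_eq_integral => //.
- apply: emeasurable_funM => //; apply: measurable_int.
  exact: (RN.f_integrable dom).
- exact: (emeasurable_funM mabs (mpdf 1)).
- exact: (ae_eqe_mul2l (fun x : measurableTypeR R => `|x%:E|%E) fE).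
have c0 : (Num.sqrt 2 : R) != 0 by rewrite gt_eqF// sqrtr_gt0.
(* Ratio of the two normalising constants, so that only the exponentials remain to be compared. *)
pose c : R := normal_peak 1 / normal_peak (Num.sqrt 2).
have c_ge0 : 0 <= c by rewrite divr_ge0// normal_peak_ge0.
apply: (@le_lt_trans _ _ (\int[mu]_x (c%:E * (normal_pdf 0 (Num.sqrt 2) x)%:E))%E).
  apply: ge0_le_integral => //=.
  - by move=> x _; rewrite mule_ge0// lee_fin normal_pdf_ge0.
  - exact: (emeasurable_funM mabs (mpdf 1)).
  - exact: (emeasurable_funM (measurable_cst _) (mpdf _)).
  move=> x _; rewrite -!EFinM lee_fin !normal_pdfE//= ?oner_eq0//.
  rewrite /c mulrCA [leRHS]mulrA divfK ?gt_eqF ?normal_peak_gt0//.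
  rewrite ler_wpM2l ?normal_peak_ge0// /normal_fun !subr0 sqr_sqrtr// expr1n.
  (* The second summand is the exponent of N(0, 2). The first absorbs [|x|], because
     [|x| <= 1 + x^2 / 4 <= exp (x^2 / 4)]; the squares of [x / 2 - 1] and [x / 2 + 1] give the left
     inequality. *)
  have -> : - x ^+ 2 / (1 *+ 2) = - (x ^+ 2 / 4) + - x ^+ 2 / (2 *+ 2) by field.
  rewrite expRD mulrA ler_piMl ?expR_ge0// expRN -ler_pdivlMr ?invr_gt0 ?expR_gt0//.
  rewrite invrK mul1r; apply: le_trans (expR_ge1Dx _).
  have := sqr_ge0 (x / 2 - 1); have := sqr_ge0 (x / 2 + 1).
  by rewrite ler_norml => u v; apply/andP; split; nra.
rewrite integralZl//; last exact: integrable_normal_pdf.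
by rewrite integral_normal_pdf mule1 ltry.
Qed.

(** * Gaussian expectation of Lipschitz functionals *)

Section lipschitz_functionals.
Context {R : realType}.
Implicit Types (F G : (nat -> R) -> R) (phi : R -> R) (L : R).

Local Notation P := (normal_prob (0 : R) 1).

(** Continuity gives measurability, and [phi] is dominated by [|phi 0| + |L| |x|], integrable since
    the normal law has a first moment. *)
Lemma integrable_normal_prob_lipschitz phi L :
  (forall x y, `|phi x - phi y| <= L * `|x - y|) ->
  P.-integrable setT (EFin \o phi).
Proof.
move=> lip.
have cphi : continuous phi.
  move=> x; apply/cvgrPdist_lt => e e0; near=> y.
  apply: le_lt_trans (lip _ _) _.
  have : `|x - y| < e / (`|L| + 1).
    by near: y; apply: cvgr_dist_lt; rewrite // divr_gt0// ltr_wpDl.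
  rewrite ltr_pdivlMr ?ltr_wpDl// => /(le_lt_trans _); apply.
  rewrite mulrC ler_wpM2l// (le_trans (ler_norm _))// lerDl//.
have mphi : measurable_fun [set: R] phi by exact: continuous_measurable_fun.
apply: (@le_integrable _ _ _ P _ _ _ (fun x => (`|phi 0|)%:E + `|L|%:E * `|x%:E|)%E).
- by [].
- exact/measurable_EFinP.
- move=> x _; rewrite /= lee_fin [leRHS]ger0_norm ?addr_ge0 ?mulr_ge0//.
  rewrite -lerBlDl (le_trans (lerB_dist _ _))// (le_trans (lip _ _))// subr0.
  by rewrite ler_wpM2r// ler_norm.
apply: integrableD => //.
  exact: finite_measure_integrable_cst.
apply: integrableZl => //; apply: integrable_abse; exact: integrable_normal_prob_id.
Unshelve. all: by end_near. Qed.

Definition scons (x : R) (g : nat -> R) : nat -> R :=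
  fun i => if i is j.+1 then g j else x.

(** Since the bound sees only the first [m] coordinates, such an [F] ignores all the others. *)
Definition lipschitz_on_first (m : nat) L F :=
  forall g g', `|F g - F g'| <= L * \sum_(i < m) `|g i - g' i|.

Lemma lipschitz_scons m L F x : lipschitz_on_first m.+1 L F ->
  lipschitz_on_first m L (F \o scons x).
Proof.
by move=> lip g g'; apply: le_trans (lip _ _) _; rewrite big_ord_recl /= subrr normr0 add0r.
Qed.

Lemma lipschitz_scons_head m L F x y g : lipschitz_on_first m.+1 L F ->
  `|F (scons x g) - F (scons y g)| <= L * `|x - y|.
Proof.
move=> lip; apply: le_trans (lip _ _) _.
by rewrite big_ord_recl /= big1 ?addr0// => i _; rewrite subrr normr0.
Qed.

Lemma gauss_expS m F :
  gauss_exp m.+1 (EFin \o F) = (\int[P]_x gauss_exp m (EFin \o (F \o scons x)))%E.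
Proof. by []. Qed.


(** The slack [c] matters: slices of a functional at [x] and [y] differ by at most [L * |x - y|],
    and taking this as [c] carries the estimate over to their expectations. *)
Definition gauss_exp_regular m L :=
  (forall F, lipschitz_on_first m L F -> gauss_exp m (EFin \o F) \is a fin_num) /\
  (forall F G c, lipschitz_on_first m L F -> lipschitz_on_first m L G ->
     (forall g, F g <= G g + c) ->
     (gauss_exp m (EFin \o F) <= gauss_exp m (EFin \o G) + c%:E)%E).

Lemma gauss_exp_regular_integrable m L F : gauss_exp_regular m L ->
  lipschitz_on_first m.+1 L F ->
  P.-integrable setT (fun x => gauss_exp m (EFin \o (F \o scons x))).
Proof.
move=> [fin le] lip; pose phi x := fine (gauss_exp m (EFin \o (F \o scons x))).
have phiE x : gauss_exp m (EFin \o (F \o scons x)) = (phi x)%:E.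
  by rewrite fineK// fin//; exact: lipschitz_scons.
rewrite (_ : (fun _ => _) = EFin \o phi); last exact/funext.
have half x y : phi x - phi y <= L * `|x - y|.
  rewrite lerBlDl -lee_fin EFinD -!phiE; apply: le; try exact: lipschitz_scons.
  move=> g; rewrite -lerBlDl; apply: le_trans (ler_norm _) _.
  exact: lipschitz_scons_head lip.
apply: (@integrable_normal_prob_lipschitz _ L) => x y.
by rewrite ler_norml lerNl opprB half/= distrC half.
Qed.

(* Finiteness and comparison are proved together: comparing two slices of [F]
   shows that the inner expectation is again Lipschitz, hence integrable. *)
Lemma gauss_exp_lipschitz m L : gauss_exp_regular m L.
Proof.
elim: m => [|m reg]; first by split => //= F G c _ _ FG; rewrite lee_fin.
have int F : lipschitz_on_first m.+1 L F -> _ := gauss_exp_regular_integrable reg (F := F).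
split=> [F lip|F G c lF lG FG].
  by rewrite gauss_expS; apply: integrable_fin_num => //; exact: int.
rewrite !gauss_expS.
have intc : P.-integrable setT (fun _ : R => c%:E).
  exact: finite_measure_integrable_cst.
rewrite -[c%:E]mule1 -(@probability_setT _ _ _ P) -integral_cst// -integralD//; last exact: int.
apply: le_integral => //.
- exact: int.
- by apply: integrableD => //; exact: int.
- by move=> x _; apply: reg.2 => [||g]; [exact: lipschitz_scons..|exact: FG].
Qed.

Lemma integrable_gauss_exp_scons m L F : lipschitz_on_first m.+1 L F ->
  P.-integrable setT (fun x => gauss_exp m (EFin \o (F \o scons x))).
Proof. exact/gauss_exp_regular_integrable/gauss_exp_lipschitz. Qed.

Lemma gauss_exp_fin_num m L F : lipschitz_on_first m L F ->
  gauss_exp m (EFin \o F) \is a fin_num.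
Proof. exact: (gauss_exp_lipschitz m L).1. Qed.

Lemma lipschitzD m L L' F G : lipschitz_on_first m L F -> lipschitz_on_first m L' G ->
  lipschitz_on_first m (L + L') (F \+ G).
Proof.
move=> lF lG g g'; rewrite /= opprD addrACA mulrDl.
by apply: le_trans (ler_normD _ _) _; rewrite lerD.
Qed.

Lemma lipschitzZ m L a F : lipschitz_on_first m L F ->
  lipschitz_on_first m (`|a| * L) (a \*o F).
Proof. by move=> lF g g'; rewrite /= -mulrBr normrM -mulrA ler_wpM2l. Qed.

Lemma lipschitzN m L F : lipschitz_on_first m L F ->
  lipschitz_on_first m L (F \o (fun g => \- g)).
Proof.
move=> lF g g'; apply: le_trans (lF _ _) _; rewrite le_eqVlt; apply/orP; left.
by apply/eqP; congr (_ * _); apply: eq_bigr => i _; rewrite /= -opprD normrN.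
Qed.

(** Here the two Lipschitz constants may differ, as they do between a supremum and a weighted sum of
    suprema. *)
Lemma le_gauss_exp m L L' F G : lipschitz_on_first m L F -> lipschitz_on_first m L' G ->
  (forall g, F g <= G g) ->
  (gauss_exp m (EFin \o F) <= gauss_exp m (EFin \o G))%E.
Proof.
elim: m F G => [|m IH] F G lF lG FG; first by rewrite lee_fin.
apply: le_integral => //.
- exact: integrable_gauss_exp_scons lF.
- exact: integrable_gauss_exp_scons lG.
- by move=> x _; apply: IH => [||g]; [exact: lipschitz_scons..|exact: FG].
Qed.

Lemma gauss_expD m L L' F G : lipschitz_on_first m L F -> lipschitz_on_first m L' G ->
  gauss_exp m (EFin \o (F \+ G)) =
  (gauss_exp m (EFin \o F) + gauss_exp m (EFin \o G))%E.
Proof.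
elim: m F G => [|m IH] F G lF lG //; rewrite !gauss_expS -integralD//; last first.
- exact: integrable_gauss_exp_scons lG.
- exact: integrable_gauss_exp_scons lF.
by apply: eq_integral => x _; rewrite -IH//; exact: lipschitz_scons.
Qed.

Lemma gauss_expZ m L a F : lipschitz_on_first m L F ->
  gauss_exp m (EFin \o (a \*o F)) = (a%:E * gauss_exp m (EFin \o F))%E.
Proof.
elim: m F => [|m IH] F lF //; rewrite !gauss_expS -integralZl//; last first.
  exact: integrable_gauss_exp_scons lF.
by apply: eq_integral => x _; rewrite -IH//; exact: lipschitz_scons.
Qed.

(** Signs are flipped one coordinate at a time: the inner ones by induction, the outermost by
    symmetry of N(0, 1). *)
Lemma gauss_expN m L F : lipschitz_on_first m L F ->
  gauss_exp m (EFin \o (F \o (fun g => \- g))) = gauss_exp m (EFin \o F).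
Proof.
elim: m F => [|m IH] F lF; rewrite ?gauss_expS.
  (* For [m = 0] the Lipschitz bound is an empty sum, so [F] is constant. *)
  rewrite /=; congr (_%:E); apply/eqP; rewrite -subr_eq0 -normr_le0.
  by apply: le_trans (lF _ _) _; rewrite big_ord0 mulr0.
pose Phi x := gauss_exp m (EFin \o (F \o scons x)).
have sconsN x : F \o (fun g => \- g) \o scons x = F \o scons (- x) \o (fun g => \- g).
  by apply/funext => g /=; congr F; apply/funext => -[|i].
have PhiN x : gauss_exp m (EFin \o ((F \o (fun g => \- g)) \o scons x)) = Phi (- x).
  by rewrite sconsN IH//; exact: lipschitz_scons.
under eq_integral do rewrite PhiN.
have intPhi : P.-integrable setT Phi by exact: integrable_gauss_exp_scons lF.
have intPhiN : P.-integrable setT (Phi \o -%R).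
  rewrite (_ : _ \o _ = fun x => gauss_exp m (EFin \o ((F \o (fun g => \- g)) \o scons x))).
    by apply: integrable_gauss_exp_scons; exact: lipschitzN lF.
  exact/funext.
exact: integral_normal_probN.
Qed.

End lipschitz_functionals.

(** * Empirical Gaussian complexity *)

Section empirical_complexity.
Context {R : realType} {T : Type} {m : nat} (S : m.-tuple T).
Implicit Types (h : T -> R) (g : nat -> R) (G W : set (T -> R)).

Definition corr h g : R := m%:R^-1 * \sum_(i < m) g i * h (tnth S i).

(** Real-valued version of the supremum in [emp_gc]; [emp_gcE] identifies the two when the class is
    nonempty and bounded. *)
Definition sup_corr G g : R := sup [set corr h g | h in G].

Definition unit_bounded G := forall h, G h -> forall t, `|h t| <= 1.

Lemma corrN h g : corr h (\- g) = - corr h g.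
Proof.
rewrite /corr -mulrN -sumrN; congr (_ * _); apply: eq_bigr => i _.
by rewrite mulNr.
Qed.

Lemma corr_lipschitz G h g g' : unit_bounded G -> G h ->
  corr h g <= corr h g' + m%:R^-1 * \sum_(i < m) `|g i - g' i|.
Proof.
move=> bG Gh; rewrite /corr -mulrDr ler_wpM2l ?invr_ge0// -big_split ler_sum//= => i _.
rewrite -lerBlDl -mulrBl (le_trans (ler_norm _))// normrM.
by rewrite ler_piMr// bG.
Qed.

(** The bound compares [g] with the zero vector, at which all correlations coincide. *)
Lemma has_sup_corr G g : G !=set0 -> unit_bounded G -> has_sup [set corr h g | h in G].
Proof.
move=> [h0 Gh0] bG; split; first by exists (corr h0 g), h0.
exists (corr h0 (fun=> 0) + m%:R^-1 * \sum_(i < m) `|g i|) => _ [h Gh <-].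
have -> : corr h0 (fun=> 0) = corr h (fun=> 0).
  by congr (_ * _); apply: eq_bigr => i _; rewrite !mul0r.
apply: le_trans (corr_lipschitz g (fun=> 0) bG Gh) _.
by under eq_bigr do rewrite subr0.
Qed.

Lemma corr_le_sup G h g : unit_bounded G -> G h -> corr h g <= sup_corr G g.
Proof.
move=> bG Gh; apply: ub_le_sup; last by exists h.
by apply: (has_sup_corr g _ bG).2; exists h.
Qed.

Lemma sup_corr_le G g c : G !=set0 -> (forall h, G h -> corr h g <= c) ->
  sup_corr G g <= c.
Proof.
move=> [h0 Gh0] Gc; apply: ge_sup; first by exists (corr h0 g), h0.
by move=> _ [h Gh <-]; exact: Gc.
Qed.

Lemma sup_corr_lipschitz G : G !=set0 -> unit_bounded G ->
  lipschitz_on_first m m%:R^-1 (sup_corr G).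
Proof.
move=> G0 bG; have half g g' :
    sup_corr G g - sup_corr G g' <= m%:R^-1 * \sum_(i < m) `|g i - g' i|.
  rewrite lerBlDl; apply: sup_corr_le => // h Gh.
  by apply: le_trans (corr_lipschitz g g' bG Gh) _; rewrite lerD2r corr_le_sup.
move=> g g'; rewrite ler_norml lerNl opprB half andbT.
by under eq_bigr do rewrite distrC; exact: half.
Qed.

Lemma emp_gcE G : G !=set0 -> unit_bounded G ->
  emp_gc S G = gauss_exp m (EFin \o sup_corr G).
Proof.
move=> G0 bG; congr gauss_exp; apply/funext => g /=.
rewrite -ereal_sup_EFin; [|exact: (has_sup_corr g G0 bG).2|exact: (has_sup_corr g G0 bG).1].
congr ereal_sup; apply/seteqP; split => x /=.
  by move=> [h Gh <-]; exists (corr h g) => //; exists h.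
by move=> [_ [h Gh <-] <-]; exists h.
Qed.

(** The correlations of a single [h] with [g] and with [- g] cancel. *)
Lemma sup_corr_addN_ge0 G g : G !=set0 -> unit_bounded G ->
  0 <= sup_corr G g + sup_corr G (\- g).
Proof.
move=> [h Gh] bG; rewrite -(subrr (corr h g)) -corrN.
by rewrite lerD// corr_le_sup.
Qed.

(** Integrating [sup_corr_addN_ge0] and using the symmetry of the Gaussian law shows that twice the
    complexity is nonnegative. *)
Lemma emp_gc_ge0 G : G !=set0 -> unit_bounded G -> (0 <= emp_gc S G)%E.
Proof.
move=> G0 bG; have lip := sup_corr_lipschitz G0 bG.
have : (gauss_exp m (EFin \o (0 \*o sup_corr G)%R) <=
    gauss_exp m (EFin \o (sup_corr G \+ (sup_corr G \o (fun g => \- g)))%R))%E.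
  apply: le_gauss_exp => [||g].
  - exact: lipschitzZ lip.
  - by apply: (lipschitzD lip); exact: lipschitzN.
  - by rewrite /= mul0r sup_corr_addN_ge0.
rewrite (gauss_expZ _ lip) mul0e (gauss_expD lip (lipschitzN lip)) (gauss_expN lip).
rewrite -emp_gcE//; case: (emp_gc S G) => //= r.
by rewrite -EFinD !lee_fin => ?; lra.
Qed.

(* The estimate for [f] and [g] is integrated against the law of [g]; the term
   with [- g] contributes the same as the one with [g] because that law is symmetric. *)
Lemma emp_gc_le W G b : 0 <= b ->
  G !=set0 -> unit_bounded G -> W !=set0 -> unit_bounded W ->
  (forall f g, W f -> corr f g <= (1 + b) * sup_corr G g + b * sup_corr G (\- g)) ->
  (emp_gc S W <= (1 + 2 * b)%:E * emp_gc S G)%E.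
Proof.
move=> b0 G0 bG W0 bW WG.
have lip := sup_corr_lipschitz G0 bG.
have lipP := lipschitzZ (1 + b) lip; have lipN := lipschitzZ b (lipschitzN lip).
apply: (@le_trans _ _ (gauss_exp m (EFin \o
    (((1 + b) \*o sup_corr G) \+ (b \*o (sup_corr G \o (fun g => \- g))))%R))).
  rewrite emp_gcE//; apply: le_gauss_exp => [||g].
  - exact: sup_corr_lipschitz.
  - exact: lipschitzD.
  - by apply: sup_corr_le => // f Wf; exact: WG.
rewrite (gauss_expD lipP lipN) (gauss_expZ _ lip) (gauss_expZ _ (lipschitzN lip)).
rewrite (gauss_expN lip) -emp_gcE//.
rewrite -ge0_muleDl ?lee_fin ?addr_ge0// -EFinD (_ : 1 + b + b = 1 + 2 * b)//.
by rewrite mulr_natl addrA.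
Qed.

End empirical_complexity.

(** * Channels and signed decompositions *)

Section quantum_channels.
Context {R : realType} {n : nat}.
Implicit Types (Phi Psi : qmap R n) (O : set (qmap R n)).

Lemma psd_delta_mx (C : numClosedFieldType) d (p : 'I_d) : psd (delta_mx p p : 'M[C]_d).
Proof.
split; first by rewrite trmx_delta map_delta_mx.
move=> v; rewrite -(mul_delta_mx (0 : 'I_1)) !mulmxA -colE -mulmxA -rowE.
by rewrite mxE big_ord1 !mxE mulrC mul_conjC_ge0.
Qed.

Lemma psd_diag_ge0 (C : numClosedFieldType) d (A : 'M[C]_d) p : psd A -> 0 <= A p p.
Proof.
move=> [_ /(_ (delta_mx p 0))].
by rewrite map_delta_mx trmx_delta -rowE -colE !mxE.
Qed.

(** Complete positivity is used with a one-dimensional ancilla, on the state [|x><x|]. *)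
Lemma channel_diag_ge0 Phi x y : is_channel Phi -> 0 <= Phi (delta_mx x x) y y.
Proof.
move=> [_ [cp _]].
have := cp 1%N _ (psd_delta_mx _ (mxtens_index (ord0, x))).
move/(psd_diag_ge0 (mxtens_index (ord0, y))); rewrite mxE mxtens_indexK /=.
congr (0 <= Phi _ y y); apply/matrixP => i j.
by rewrite !mxE !(can_eq (@mxtens_indexK _ _)).
Qed.

Lemma fPhiE Phi (z : Zdom n) : fPhi Phi z = complex.Re (Phi (delta_mx z.1 z.1) z.2 z.2).
Proof.
rewrite /fPhi -(mul_delta_mx (0 : 'I_1) z.2 z.2) mulmxA mxtrace_mulC -rowE -colE.
by rewrite trace_mx11 !mxE.
Qed.

(** The diagonal entries of the output state are nonnegative and, by trace preservation, sum to
    1. *)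
Lemma channel_fPhi_le1 Phi z : is_channel Phi -> `|fPhi Phi z| <= 1.
Proof.
move=> chPhi; have tr1 : \tr (Phi (delta_mx z.1 z.1)) = 1.
  rewrite chPhi.2.2 /mxtrace (bigD1 z.1)//= big1 ?addr0 ?mxE ?eqxx// => i iz.
  by rewrite mxE (negbTE iz).
have := channel_diag_ge0 z.1 z.2 chPhi.
have : Phi (delta_mx z.1 z.1) z.2 z.2 <= 1.
  rewrite -tr1 /mxtrace (bigD1 z.2)//= lerDl sumr_ge0// => i _.
  exact: channel_diag_ge0.
rewrite fPhiE !lecE => /andP[_ le1] /andP[_ ge0].
by rewrite ger0_norm.
Qed.

Lemma is_channel_id : is_channel (idfun : qmap R n).
Proof.
split=> //; split=> // k X; congr psd; apply/matrixP => p q.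
by rewrite !mxE -!surjective_pairing !mxtens_unindexK.
Qed.

Lemma ampl_comp Phi Psi k (X : 'M[complex R]_(k * qdim n)) :
  ampl (Phi \o Psi) X = ampl Phi (ampl Psi X).
Proof.
apply/matrixP => p q; rewrite !mxE /=; congr (Phi _ _ _).
by apply/matrixP => i j; rewrite !mxE !mxtens_indexK.
Qed.

Lemma is_channel_comp Phi Psi : is_channel Phi -> is_channel Psi ->
  is_channel (Phi \o Psi).
Proof.
move=> [lPhi [cpPhi trPhi]] [lPsi [cpPsi trPsi]]; split=> [a X Y|].
  by rewrite /= lPsi lPhi.
split=> [k X psdX|X]; first by rewrite ampl_comp; apply/cpPhi/cpPsi.
by rewrite /= trPhi trPsi.
Qed.

Lemma comp_k_channel O Psi k Phi : (forall F, O F -> is_channel F) -> is_channel Psi ->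
  comp_k O Psi k Phi -> is_channel Phi.
Proof.
move=> chO chPsi [s [_ [sO [_ ->]]]].
elim: s sO => [|o s IH] sO /=; first exact: is_channel_id.
apply: is_channel_comp; last by apply: IH => j js; exact: (sO j.+1).
by case: o sO => [F|] sO //=; apply: chO; exact: (sO 0%N).
Qed.

End quantum_channels.

(** * Conic combinations of free channels and their differences *)

Section cones.
Context {R : realType} {n : nat}.
Implicit Types (Phi Psi A B : qmap R n) (O : set (qmap R n)).

Local Notation "x %:C" := (real_complex R x).

(** The dilate [t Conv(O)]. Allowing any finite index type lets sums and compositions be indexed by
    disjoint unions and products. *)
Definition cone O (t : R) A : Prop :=
  exists (I : finType) (w : I -> R) (P : I -> qmap R n),
    [/\ forall i, 0 <= w i, \sum_i w i = t, forall i, O (P i) &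
        forall X, A X = \sum_i (w i)%:C *: P i X].

Lemma cone1 O A : O A -> cone O 1 A.
Proof.
move=> OA; exists 'I_1, (fun=> 1), (fun=> A); split=> // [|X].
  by rewrite big_ord1.
by rewrite big_ord1 rmorph1 scale1r.
Qed.

Lemma cone0 O : cone O 0 (fun=> 0).
Proof.
by exists void, (fun=> 0), (@of_void _); split=> // [|X];
  rewrite big_pred0 //; case.
Qed.

Lemma conv_hull_cone O A : conv_hull O A -> cone O 1 A.
Proof. by move=> [l [w [P [w0 [w1 [OP ->]]]]]]; exists 'I_l, w, P; split. Qed.

Lemma coneD O s t A B : cone O s A -> cone O t B ->
  cone O (s + t) (fun X => A X + B X).
Proof.
move=> [I [v [P [v0 <- OP AE]]]] [J [w [Q [w0 <- OQ BE]]]].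
exists (I + J)%type, (fun k => match k with inl i => v i | inr j => w j end),
  (fun k => match k with inl i => P i | inr j => Q j end); split=> [[]|||X] //=.
- by rewrite big_sumType.
- by case.
- by rewrite big_sumType /= AE BE.
Qed.

Lemma coneZ O a t A : 0 <= a -> cone O t A -> cone O (a * t) (fun X => a%:C *: A X).
Proof.
move=> a0 [I [v [P [v0 <- OP AE]]]]; exists I, (fun i => a * v i), P; split=> // [i||X].
- exact: mulr_ge0.
- by rewrite mulr_sumr.
- by rewrite AE scaler_sumr; apply: eq_bigr => i _; rewrite rmorphM scalerA.
Qed.

Lemma eq_cone O s t A B : s = t -> A =1 B -> cone O s A -> cone O t B.
Proof.
by move=> <- AB [I [v [P [v0 vs OP AE]]]]; exists I, v, P; split=> // X; rewrite -AB.
Qed.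

Section linear.
Variable O : set (qmap R n).
Hypothesis chO : forall Phi, O Phi -> is_channel Phi.
Hypothesis compO : forall Phi Psi, O Phi -> O Psi -> O (Phi \o Psi).

Lemma coneP t A (a : complex R) X Y : cone O t A -> A (a *: X + Y) = a *: A X + A Y.
Proof.
move=> [I [v [P [_ _ OP AE]]]]; rewrite !AE scaler_sumr -big_split /=.
apply: eq_bigr => i _; rewrite (chO (OP i)).1 scalerDr !scalerA.
by rewrite [_ * a]mulrC.
Qed.

Lemma coneB t A X Y : cone O t A -> A (X - Y) = A X - A Y.
Proof. by move=> cA; rewrite addrC -scaleN1r (coneP _ _ _ cA) scaleN1r addrC. Qed.

Lemma cone_sum t A (I : finType) (F : I -> qmat R n) (w : I -> complex R) :
  cone O t A -> A (\sum_i w i *: F i) = \sum_i w i *: A (F i).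
Proof.
move=> cA; have A0 : A 0 = 0 by rewrite -[X in A X](subrr 0) (coneB _ _ cA) subrr.
by apply: (big_rec2 (fun x y => A x = y)) => // i y x _ <-; rewrite (coneP _ _ _ cA).
Qed.

(** Expanding by linearity gives the compositions [P i \o Q j] with weights [v i * w j], and these
    compositions lie in [O]. *)
Lemma cone_comp s t A B : cone O s A -> cone O t B -> cone O (s * t) (A \o B).
Proof.
move=> cA [J [w [Q [w0 <- OQ BE]]]].
have compE X : (A \o B) X = \sum_j (w j)%:C *: A (Q j X).
  by rewrite /= BE (cone_sum _ _ cA).
move: cA => [I [v [P [v0 <- OP AE]]]].
exists (I * J)%type, (fun k => v k.1 * w k.2), (fun k => P k.1 \o Q k.2).
split=> [k|||X]; [exact: mulr_ge0| | |].
- by rewrite mulr_suml -(pair_bigA _ (fun i j => v i * w j))/=;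
    apply: eq_bigr => i _; rewrite mulr_sumr.
- by move=> k; exact: compO.
rewrite compE -(pair_bigA _ (fun i j => (v i * w j)%:C *: (P i \o Q j) X))/= exchange_big.
apply: eq_bigr => j _; rewrite AE scaler_sumr; apply: eq_bigr => i _.
by rewrite scalerA -rmorphM mulrC.
Qed.

(** Signed decomposition with total weight [1 + 2 b]; the positive part exceeds the negative one by
    1. *)
Definition cone_diff (b : R) Phi : Prop := exists A B,
  [/\ cone O (1 + b) A, cone O b B & forall X, Phi X = A X - B X].

Lemma cone_diff0 Phi : O Phi -> cone_diff 0 Phi.
Proof.
move=> OPhi; exists Phi, (fun=> 0); split=> [||X]; last by rewrite subr0.
- by rewrite addr0; exact: cone1.
- exact: cone0.
Qed.

(* (A - B)(A' - B') = (AA' + BB') - (AB' + BA'), so the weights 1 + 2b multiply. *)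
Lemma cone_diff_comp b c Phi Psi : cone_diff b Phi -> cone_diff c Psi ->
  cone_diff (b + c + 2 * b * c) (Phi \o Psi).
Proof.
move=> [A [B [cA cB PhiE]]] [A' [B' [cA' cB' PsiE]]].
exists (fun X => A (A' X) + B (B' X)), (fun X => A (B' X) + B (A' X)); split=> [||X].
- apply: (eq_cone _ _ (coneD (cone_comp cA cA') (cone_comp cB cB'))) => //; ring.
- apply: (eq_cone _ _ (coneD (cone_comp cA cB') (cone_comp cB cA'))) => //; ring.
- rewrite /= PhiE PsiE (coneB _ _ cA) (coneB _ _ cB).
  rewrite !opprD !opprK -!addrA; congr (_ + _); rewrite addrCA [in LHS]addrC.
  by rewrite -!addrA addrCA.
Qed.

(** Clearing the denominator in the definition of robustness gives [Phi = (1 + lam) M - lam Phi']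
    with [M] and [Phi'] in the convex hull. The inequality is strict because the infimum may not be
    attained. *)
Lemma robustness_lt_cone_diff Phi (r : R) : (robustness O Phi < r%:E)%E ->
  exists lam, [/\ 0 <= lam, lam < r & cone_diff lam Phi].
Proof.
move=> /ereal_inf_lt[_ [lam [lam0 [Phi' [/conv_hull_cone c' /conv_hull_cone c]]] <-]].
rewrite lte_fin => lamr; exists lam; split=> //.
have lam1 : 0 < 1 + lam by rewrite ltr_pwDl.
exists (fun X => Phi X + lam%:C *: Phi' X), (fun X => lam%:C *: Phi' X); split=> [||X].
- apply: (eq_cone _ _ (coneZ (ltW lam1) c)) => [|X]; first by rewrite mulr1.
  by rewrite scalerA divff ?scale1r// fmorph_eq0 gt_eqF.
- by apply: (eq_cone _ _ (coneZ lam0 c')) => //; rewrite mulr1.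
- by rewrite addrK.
Qed.

Lemma comp_k_cone_diff Psi k lam Phi : 0 <= lam -> cone_diff lam Psi ->
  comp_k O Psi k Phi ->
  exists b, [/\ 0 <= b, 1 + 2 * b <= (1 + 2 * lam) ^+ k & cone_diff b Phi].
Proof.
move=> lam0 dPsi [s [s0 [sO [sk ->]]]].
(* The weight is computed exactly from the number of occurrences of [Psi]; the bound with [k]
   follows since [1 + 2 lam >= 1]. *)
suff [b [b0 bE db]] : exists b, [/\ 0 <= b,
    1 + 2 * b = (1 + 2 * lam) ^+ count (fun o => if o is None then true else false) s &
    cone_diff b (foldr (fun o acc => odflt Psi o \o acc) idfun s)].
  exists b; split=> //; rewrite bE; apply: ler_weXn2l => //.
  by rewrite lerDl mulr_ge0.
elim: s s0 sO {sk} => [//|o s IH] _ sO.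
have [c [c0 cE dc]] : exists c, [/\ 0 <= c,
    1 + 2 * c = (1 + 2 * lam) ^+ nat_of_bool (if o is None then true else false) &
    cone_diff c (odflt Psi o)].
  case: o sO => [F|] sO; [exists 0|exists lam] => /=; split=> //.
  - by rewrite mulr0 addr0 expr0.
  - by apply: cone_diff0; exact: (sO 0%N).
(* The induction starts at one-element lists, since the identity is not assumed to lie in [O]. *)
case: s IH sO => [|o' s] IH sO; first by exists c; rewrite /= addn0; split=> //; exact: dc.
have [b [b0 bE db]] := IH isT (fun j => sO j.+1).
exists (c + b + 2 * c * b); split; last exact: cone_diff_comp.
- by rewrite !addr_ge0 ?mulr_ge0.
- rewrite [count _ _]/= exprD -cE -bE; ring.
Qed.

(** Correlation is linear in the channel, so that of [A] is a nonnegative combination, of total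
    weight [t], of correlations bounded by [M]. *)
Lemma corr_cone m (S : m.-tuple (Zdom n)) t A g M : cone O t A ->
  (forall Phi, O Phi -> corr S (fPhi Phi) g <= M) -> corr S (fPhi A) g <= t * M.
Proof.
move=> [I [w [P [w0 <- OP AE]]]] OM.
have fE z : fPhi A z = \sum_i w i * fPhi (P i) z.
  rewrite fPhiE AE summxE raddf_sum; apply: eq_bigr => i _.
  by rewrite fPhiE mxE /=; case: (P i _ _ _) => a b /=; rewrite mul0r subr0.
have -> : corr S (fPhi A) g = \sum_i w i * corr S (fPhi (P i)) g.
  rewrite /corr; under eq_bigr do rewrite fE mulr_sumr.
  rewrite exchange_big mulr_sumr; apply: eq_bigr => i _ /=.
  rewrite mulrCA; congr (_ * _); rewrite mulr_sumr; apply: eq_bigr => j _.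
  by rewrite mulrCA.
by rewrite mulr_suml ler_sum// => i _; rewrite ler_wpM2l// OM.
Qed.

Lemma Fcls_unit_bounded (W : set (qmap R n)) : (forall Phi, W Phi -> is_channel Phi) ->
  unit_bounded (Fcls W).
Proof. by move=> chW _ [Phi WPhi <-] z; exact/channel_fPhi_le1/chW. Qed.

Lemma Fcls_nonempty (W : set (qmap R n)) : W !=set0 -> Fcls W !=set0.
Proof. by move=> [Phi WPhi]; exists (fPhi Phi), Phi. Qed.

Lemma emp_gc_le_cone_diff (W : set (qmap R n)) m (S : m.-tuple (Zdom n)) c :
  O !=set0 -> W !=set0 -> (forall Phi, W Phi -> is_channel Phi) -> 0 <= c ->
  (forall Phi, W Phi -> exists2 b, b <= c & cone_diff b Phi) ->
  (emp_gc S (Fcls W) <= (1 + 2 * c)%:E * emp_gc S (Fcls O))%E.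
Proof.
move=> O0 W0 chW c0 WO.
have bO := Fcls_unit_bounded chO; have FO0 := Fcls_nonempty O0.
apply: emp_gc_le => //; [exact: Fcls_nonempty|exact: Fcls_unit_bounded|].
move=> _ g [Phi WPhi <-]; have [b bc [A [B [cA cB PhiE]]]] := WO _ WPhi.
have -> : corr S (fPhi Phi) g = corr S (fPhi A) g + corr S (fPhi B) (\- g).
  rewrite corrN /corr -mulrBr -sumrB; congr (_ * _); apply: eq_bigr => i _.
  by rewrite -mulrBr !fPhiE PhiE !mxE raddfB.
have sup_ub g' Psi : O Psi -> corr S (fPhi Psi) g' <= sup_corr S (Fcls O) g'.
  by move=> OPsi; apply: corr_le_sup => //; exists Psi.
have := corr_cone cA (sup_ub g); have := corr_cone cB (sup_ub (\- g)).
(* Because the two suprema have nonnegative sum, [(1 + b) M + b N] is nondecreasing in [b], so [b]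
   can be replaced by the uniform [c]. *)
have := sup_corr_addN_ge0 S g FO0 bO.
move: (sup_corr _ _ _) (sup_corr _ _ _) => M N; nra.
Qed.

End linear.
End cones.

(** * Gaussian complexity of compositions *)

(** Bounds are available only for parameters strictly above a robustness; right continuity extends
    them to the infimum itself. *)
Lemma le_right_limit_expr (R : realType) (k : nat) (r e w : R) :
  (forall x, r < x -> w <= (1 + 2 * x) ^+ k * e) -> w <= (1 + 2 * r) ^+ k * e.
Proof.
move=> wle; pose f (x : R) := (1 + 2 * x) ^+ k * e.
have cf : f x @[x --> r^'+] --> f r.
  apply: cvg_at_right_filter; apply: cvgMr_tmp.
  apply: (@cvg_comp _ _ _ (fun x => 1 + 2 * x) (fun y => y ^+ k)); last first.
    exact: exprn_continuous.
  by apply: cvgD; [exact: cvg_cst|apply: cvgMl_tmp; exact: cvg_id].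
apply: (cvgr_to_ge cf); near=> x; apply: wle; near: x; exact: nbhs_right_gt.
Unshelve. all: by end_near. Qed.

Section gamma_star.
Context {R : realType} {n : nat} (O : set (qmap R n)) (Psi : qmap R n) (k : nat).
Hypothesis chO : forall Phi, O Phi -> is_channel Phi.
Hypothesis O0 : O !=set0.
Hypothesis compO : forall Phi Phi', O Phi -> O Phi' -> O (Phi \o Phi').
Hypothesis chPsi : is_channel Psi.
Hypothesis robPsi : (robustness O Psi < +oo)%E.

Lemma robustness_ge0 Phi : (0 <= robustness O Phi)%E.
Proof. by apply: le_ereal_inf_tmp => _ [lam [lam0 _] <-]; rewrite lee_fin. Qed.

Lemma robustness_le_gamma_max Phi : is_channel Phi -> (robustness O Phi <= gamma_max O)%E.
Proof. by move=> chPhi; apply: ereal_sup_ubound; exists Phi. Qed.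

Lemma comp_k_nonempty : comp_k O Psi k !=set0.
Proof.
case: O0 => F OF; exists F, [:: Some F]; split=> //; split; first by case.
by split=> //=; exact/funext.
Qed.

Lemma emp_gc_comp_k_le_gamma_star m (S : m.-tuple (Zdom n)) :
  (emp_gc S (Fcls (comp_k O Psi k)) <= gamma_star O Psi k * emp_gc S (Fcls O))%E.
Proof.
have chW Phi : comp_k O Psi k Phi -> is_channel Phi by exact: comp_k_channel.
have W0 := comp_k_nonempty.
have bound := emp_gc_le_cone_diff chO S O0 W0 chW.
have fin (V : set (qmap R n)) : V !=set0 -> (forall Phi, V Phi -> is_channel Phi) ->
    emp_gc S (Fcls V) \is a fin_num.
  move=> V0 chV; have bV := Fcls_unit_bounded chV; have FV0 := Fcls_nonempty V0.
  by rewrite emp_gcE//; exact: gauss_exp_fin_num (sup_corr_lipschitz S FV0 bV).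
move: bound; rewrite -(fineK (fin _ O0 chO)) -(fineK (fin _ W0 chW)).
move: (fine _) (fine _) => e w bound.
have le_k : w <= (1 + 2 * fine (robustness O Psi)) ^+ k * e.
  apply: le_right_limit_expr => x; rewrite -lte_fin fineK; last first.
    by rewrite ge0_fin_numE ?robustness_ge0.
  move=> /(robustness_lt_cone_diff (O := O))[lam [lam0 lamx dPsi]].
  (* Chosen so that the total weight [1 + 2 c] equals [(1 + 2 x)^k]. *)
  pose c := ((1 + 2 * x) ^+ k - 1) / 2.
  have cE : 1 + 2 * c = (1 + 2 * x) ^+ k by rewrite /c; field.
  have x0 : 0 <= x by apply: le_trans (ltW lamx).
  have c0 : 0 <= c.
    by rewrite divr_ge0// subr_ge0 exprn_ege1// lerDl mulr_ge0.
  rewrite -cE -lee_fin EFinM; apply: bound => // Phi WPhi.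
  have [b [b0 bk db]] := comp_k_cone_diff chO compO lam0 dPsi WPhi.
  exists b => //; suff : 1 + 2 * b <= 1 + 2 * c by lra.
  rewrite cE (le_trans bk)// lerXn2r ?nnegrE ?addr_ge0 ?mulr_ge0//.
  by rewrite lerD2l ler_wpM2l// ltW.
rewrite /gamma_star minEle; case: ifPn => [|_]; last by rewrite -EFinM lee_fin.
(* In this branch [1 + 2 gamma_max] is at most a finite number, which excludes [+oo]; nonnegativity
   of the robustness of [Psi] excludes [-oo]. *)
have := robustness_le_gamma_max chPsi; move: robustness_le_gamma_max.
case: (gamma_max O) => [r| |] rob_le /(le_trans (robustness_ge0 Psi)) //; last first.
  by rewrite gt0_muley ?lte_fin// addey// leye_eq.
rewrite lee_fin => r0 _; rewrite (_ : 1 + _ = (1 + 2 * r)%:E)%E // -EFinM lee_fin.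
(* The limit lemma is used with exponent 1: each composition is itself a channel of robustness at
   most [r], so it is decomposed directly. *)
rewrite -[1 + 2 * r]expr1; apply: le_right_limit_expr => x rx.
have x0 : 0 <= x by rewrite (le_trans r0) ?ltW.
rewrite expr1 -lee_fin EFinM; apply: bound => // Phi /chW chPhi.
have /(robustness_lt_cone_diff (O := O))[lam [_ lamx dPhi]] : (robustness O Phi < x%:E)%E.
  by apply: le_lt_trans (rob_le _ chPhi) _; rewrite lte_fin.
by exists lam => //; exact: ltW.
Qed.

Lemma exp_gc_comp_k_le_gamma_star m (D : Zdom n -> R) : is_distr D ->
  (exp_gc m D (Fcls (comp_k O Psi k)) <= gamma_star O Psi k * exp_gc m D (Fcls O))%E.
Proof.
move=> [D0 _]; have prod_ge0 (S : m.-tuple (Zdom n)) : 0 <= \prod_(i < m) D (tnth S i).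
  exact: prodr_ge0.
(* Distributing an extended real factor over the sum relies on nonnegative terms, hence on
   [emp_gc_ge0]. *)
rewrite /exp_gc ge0_sume_distrr => [|S _]; last first.
  rewrite mule_ge0 ?lee_fin// emp_gc_ge0//; [exact: Fcls_nonempty|exact: Fcls_unit_bounded].
apply: lee_sum => S _; rewrite muleCA lee_wpmul2l ?lee_fin//.
exact: emp_gc_comp_k_le_gamma_star.
Qed.

End gamma_star.

Unset Implicit Arguments.

Theorem mainTheorem11 (R : realType) (n : nat) (O : set (qmap R n))
    (Psi : qmap R n) (k : nat) :
  (forall Phi, O Phi -> is_channel Phi) ->
  O !=set0 ->
  (forall Phi1 Phi2, O Phi1 -> O Phi2 -> O (Phi1 \o Phi2)) ->
  is_channel Psi ->
  (robustness O Psi < +oo)%E ->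
  (forall (m : nat) (S : m.-tuple (Zdom n)),
     (emp_gc S (Fcls (comp_k O Psi k)) <= gamma_star O Psi k * emp_gc S (Fcls O))%E) /\
  (forall (m : nat) (D : Zdom n -> R), is_distr D ->
     (exp_gc m D (Fcls (comp_k O Psi k)) <= gamma_star O Psi k * exp_gc m D (Fcls O))%E).
Proof.
move=> chO O0 compO chPsi robPsi; split=> [m S|m D].
- exact: emp_gc_comp_k_le_gamma_star.
- exact: exp_gc_comp_k_le_gamma_star.
Qed.
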